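(* Let $A=\begin{bmatrix} a & b & c\\ f & g & h\\ p & q & r\end{bmatrix}$ be a $3\times 3$ matrix with entries in the quaternions $\mathbb{H}$, none of whose entries outside the diagonal is zero. Let $\pi_A=g-hc^{-1}b$ and let $\mu_A\colon\mathbb{H}\to\mathbb{H}$ be the rational characteristic map of $A$ defined by $$\mu_A(\pi_A)=\left(q-(r-\pi_A)c^{-1}b\right)\left(f-hc^{-1}(a-\pi_A)\right)$$ and, for $\lambda\neq\pi_A$, $$\mu_A(\lambda)=(\pi_A-\lambda)\left[p-(r-\lambda)c^{-1}(a-\lambda)-\left(q-(r-\lambda)c^{-1}b\right)(\pi_A-\lambda)^{-1}\left(f-hc^{-1}(a-\lambda)\right)\right],$$ extended to $S^4=\mathbb{H}\cup\{\infty\}$ by $\mu_A(\infty)=\infty$. If $\mu_A$ is continuous, then the map $\mu_A\colon S^4\to S^4$ has topological degree $3$.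
   Context: $S^4=\mathbb{H}\cup\{\infty\}$ is the one-point compactification of $\mathbb{H}\cong\mathbb{R}^4$. One has $|\mu_A(\lambda)|\to\infty$ as $|\lambda|\to\infty$, so the extension is continuous at $\infty$. Topological degree means the Brouwer degree of a continuous map $S^4\to S^4$. *)

(* Defs.v *)
From HB Require Import structures.
From mathcomp Require Import all_boot all_order all_algebra.
From mathcomp Require Import all_classical all_reals all_analysis.
From mathcomp Require Import ring.
Import Order.TTheory GRing.Theory Num.Theory.
Import numFieldNormedType.Exports.

Set Implicit Arguments.
Unset Strict Implicit.
Unset Printing Implicit Defensive.

Local Open Scope classical_set_scope.
Local Open Scope ring_scope.

(* The quaternion x0 + x1 i + x2 j + x3 k is the row vector (x0, x1, x2, x3),
   so that the topology and the differential calculus are those of R^4. The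
   norm inherited from row vectors is the sup norm, not the multiplicative
   Euclidean norm; only the topology it induces is used. *)
Definition quat (R : Type) : Type := 'rV[R]_4.

HB.instance Definition _ (R : realType) :=
  NormedModule.copy (quat R) 'rV[R]_4.

Section QuaternionAlgebra.
Variable R : realType.
Implicit Types x y z : quat R.

Definition mkquat (a b c d : R) : quat R := \row_(i < 4) [:: a; b; c; d]`_i.

Definition coefq x (i : 'I_4) : R := (x : 'rV[R]_4) 0 i.

Local Notation "x `_i0" := (coefq x 0) (at level 2, format "x `_i0").
Local Notation "x `_i1" := (coefq x 1) (at level 2, format "x `_i1").
Local Notation "x `_i2" := (coefq x 2) (at level 2, format "x `_i2").
Local Notation "x `_i3" := (coefq x 3) (at level 2, format "x `_i3").

Definition oneq : quat R := mkquat 1 0 0 0.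

Definition mulq x y : quat R := mkquat
  (x`_i0 * y`_i0 - x`_i1 * y`_i1 - x`_i2 * y`_i2 - x`_i3 * y`_i3)
  (x`_i0 * y`_i1 + x`_i1 * y`_i0 + x`_i2 * y`_i3 - x`_i3 * y`_i2)
  (x`_i0 * y`_i2 - x`_i1 * y`_i3 + x`_i2 * y`_i0 + x`_i3 * y`_i1)
  (x`_i0 * y`_i3 + x`_i1 * y`_i2 - x`_i2 * y`_i1 + x`_i3 * y`_i0).

Definition conjq x : quat R := mkquat x`_i0 (- x`_i1) (- x`_i2) (- x`_i3).

Definition normsq x : R :=
  x`_i0 ^+ 2 + x`_i1 ^+ 2 + x`_i2 ^+ 2 + x`_i3 ^+ 2.

Definition invq x : quat R := (normsq x)^-1 *: conjq x.

Lemma quatP x y :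
  x`_i0 = y`_i0 -> x`_i1 = y`_i1 -> x`_i2 = y`_i2 -> x`_i3 = y`_i3 -> x = y.
Proof.
rewrite /coefq => h0 h1 h2 h3; apply/rowP => -[[|[|[|[|//]]]] lti].
- by rewrite (_ : Ordinal lti = 0) //; exact/val_inj.
- by rewrite (_ : Ordinal lti = 1) //; exact/val_inj.
- by rewrite (_ : Ordinal lti = 2) //; exact/val_inj.
- by rewrite (_ : Ordinal lti = 3) //; exact/val_inj.
Qed.

Lemma coefq_mk a b c d :
  ((mkquat a b c d)`_i0 = a) * ((mkquat a b c d)`_i1 = b) *
  ((mkquat a b c d)`_i2 = c) * ((mkquat a b c d)`_i3 = d).
Proof. by rewrite /coefq !mxE. Qed.

Lemma coefqD x y i : coefq (x + y) i = coefq x i + coefq y i.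
Proof. by rewrite /coefq mxE. Qed.

Lemma coefqZ (a : R) x i : coefq (a *: x) i = a * coefq x i.
Proof. by rewrite /coefq mxE. Qed.

Lemma coefq0 i : coefq (0 : quat R) i = 0.
Proof. by rewrite /coefq mxE. Qed.

Fact mulqA : associative mulq.
Proof. by move=> x y z; apply: quatP; rewrite /mulq !coefq_mk; ring. Qed.

Fact mul1q : left_id oneq mulq.
Proof. by move=> x; apply: quatP; rewrite /mulq /oneq !coefq_mk; ring. Qed.

Fact mulq1 : right_id oneq mulq.
Proof. by move=> x; apply: quatP; rewrite /mulq /oneq !coefq_mk; ring. Qed.

Fact mulqDl : left_distributive mulq +%R.
Proof.
by move=> x y z; apply: quatP; rewrite coefqD /mulq !coefq_mk !coefqD; ring.
Qed.

Fact mulqDr : right_distributive mulq +%R.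
Proof.
by move=> x y z; apply: quatP; rewrite coefqD /mulq !coefq_mk !coefqD; ring.
Qed.

Fact oneq_neq0 : oneq != 0.
Proof.
apply/eqP => /(congr1 (fun x => x`_i0)).
by rewrite coefq0 coefq_mk => /eqP; rewrite oner_eq0.
Qed.

HB.instance Definition _ := GRing.Zmodule_isNzRing.Build (quat R)
  mulqA mul1q mulq1 mulqDl mulqDr oneq_neq0.

Lemma normsq_neq0 x : x != 0 -> normsq x != 0.
Proof.
apply: contra_neq => /eqP; rewrite /normsq.
rewrite !paddr_eq0 ?addr_ge0 ?sqr_ge0 // !sqrf_eq0.
by move=> /andP[/andP[/andP[/eqP ? /eqP ?] /eqP ?] /eqP ?];
  apply: quatP; rewrite coefq0.
Qed.

Fact mulVq : {in [pred x : quat R | x != 0], left_inverse 1 invq *%R}.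
Proof.
move=> x; rewrite inE => /normsq_neq0 nx0; apply: quatP;
by rewrite [LHS]coefq_mk /invq !coefqZ [RHS]coefq_mk /conjq !coefq_mk;
  move: nx0; rewrite /normsq => nx0; field.
Qed.

Fact mulqV : {in [pred x : quat R | x != 0], right_inverse 1 invq *%R}.
Proof.
move=> x; rewrite inE => /normsq_neq0 nx0; apply: quatP;
by rewrite [LHS]coefq_mk /invq !coefqZ [RHS]coefq_mk /conjq !coefq_mk;
  move: nx0; rewrite /normsq => nx0; field.
Qed.

Fact unitqP x y : y * x = 1 /\ x * y = 1 -> x != 0.
Proof.
move=> [yx1 _]; apply: contra_eq_neq yx1 => ->.
by rewrite mulr0 eq_sym oner_eq0.
Qed.

Fact invq_out : {in [predC [pred x : quat R | x != 0]], invq =1 id}.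
Proof.
move=> x; rewrite !inE negbK => /eqP ->.
by apply: quatP; rewrite /invq coefqZ coefq_mk !coefq0 ?oppr0 mulr0.
Qed.

HB.instance Definition _ := GRing.NzRing_hasMulInverse.Build (quat R)
  mulVq mulqV unitqP invq_out.

End QuaternionAlgebra.

Section CharacteristicMap.
Variables (R : realType) (A : 'M[quat R]_3).

Local Notation a := (A 0 0).
Local Notation b := (A 0 1).
Local Notation c := (A 0 2).
Local Notation f := (A 1 0).
Local Notation g := (A 1 1).
Local Notation h := (A 1 2).
Local Notation p := (A 2 0).
Local Notation q := (A 2 1).
Local Notation r := (A 2 2).

Definition charpole : quat R := g - h * c^-1 * b.
Local Notation pi_A := charpole.

Definition charmap (l : quat R) : quat R :=
  if l == pi_A then
    (q - (r - pi_A) * c^-1 * b) * (f - h * c^-1 * (a - pi_A))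
  else
    (pi_A - l) *
      (p - (r - l) * c^-1 * (a - l)
       - (q - (r - l) * c^-1 * b) * (pi_A - l)^-1 * (f - h * c^-1 * (a - l))).

End CharacteristicMap.

Definition homotopic (R : realType) (X Y : topologicalType) (f g : X -> Y) :=
  exists H : X * R -> Y,
    [/\ {within [set: X] `*` `[0, 1], continuous H},
        forall x, H (x, 0) = f x & forall x, H (x, 1) = g x].

(* S^4 = H + {infinity}, the point at infinity being None. *)
Notation S4 R := (one_point_compactification (quat R)).

Section Degree.
Variable R : realType.

Definition extend_infty (m : quat R -> quat R) : S4 R -> S4 R := omap m.

(* The smooth structure and the orientation of S^4 are given by two charts:
   the identity of H around the points of H, and x |-> x^-1 (sending infinity
   to 0) around infinity. The transition map x |-> x^-1 = conj(x) / |x|^2 is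
   an orientation-preserving diffeomorphism of H \ {0}. *)
Definition at_infty (s : S4 R) : bool := ~~ isSome s.

Definition coord (infty : bool) (s : S4 R) : quat R :=
  match s with
  | Some x => if infty then x^-1 else x
  | None => 0
  end.

Definition param (infty : bool) (u : quat R) : S4 R :=
  if infty then (if u == 0 then None else Some u^-1) else Some u.

Definition local_rep (f : S4 R -> S4 R) (s : S4 R) : 'rV[R]_4 -> 'rV[R]_4 :=
  fun u => coord (at_infty (f s)) (f (param (at_infty s) u)).

Definition local_coord (s : S4 R) : 'rV[R]_4 := coord (at_infty s) s.

Definition C1_map (f : S4 R -> S4 R) : Prop :=
  continuous f /\
  forall s : S4 R,
    (\forall u \near local_coord s, differentiable (local_rep f s) u) /\
    {for local_coord s, continuous (jacobian (local_rep f s))}.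

Definition jacobian_det (f : S4 R -> S4 R) (s : S4 R) : R :=
  \det (jacobian (local_rep f s) (local_coord s)).

Definition regular_value (f : S4 R -> S4 R) (y : S4 R) : Prop :=
  forall s, f s = y -> jacobian_det f s != 0.

(* A finitely supported sum: the fibre of a C^1 map over a regular value is
   discrete and closed in the compact space S^4. *)
Definition signed_count (f : S4 R -> S4 R) (y : S4 R) : int :=
  \sum_(s \in f @^-1` [set y]) sgz (jacobian_det f s).

(* The Brouwer degree of a continuous map f : S^4 -> S^4 is the number of
   preimages, counted with sign, of a regular value of a C^1 map homotopic to
   f. Such data exist (approximation and Sard's theorem) and the number does
   not depend on them (homotopy invariance), so at most one d has this
   property. *)
Definition has_degree (f : S4 R -> S4 R) (d : int) : Prop :=
  continuous f /\
  exists (g : S4 R -> S4 R) (y : S4 R),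
    [/\ homotopic R f g, C1_map g, regular_value g y & signed_count g y = d].

End Degree.

(* Main.v *)
Require Import Defs.
From HB Require Import structures.
From mathcomp Require Import all_boot all_order all_algebra.
From mathcomp Require Import all_classical all_reals all_analysis.
From mathcomp Require Import ring lra.
Import Order.TTheory GRing.Theory Num.Theory.
Import numFieldNormedType.Exports.

(* Multiplying out, mu_A(x) = x^2 c^-1 x + O(|x|^2) at infinity, because the
   inverse of pi_A - x only occurs conjugated by pi_A - x. Hence, for a path u
   from c^-1 to 1 in H \ {0}, the maps
     (1 - t) (mu_A(x) - x^2 c^-1 x) + x^2 u(t) x
   tend to infinity with x uniformly in t, and extend to a homotopy on S^4 from
   mu_A to x |-> x^3. The latter reads u |-> u^3 in both charts of S^4, so it is
   C^1, and its fibre over i consists of the three complex cube roots of i, at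
   each of which the Jacobian determinant is positive. *)

Set Implicit Arguments.
Unset Strict Implicit.
Unset Printing Implicit Defensive.

Local Open Scope classical_set_scope.
Local Open Scope ring_scope.

(** * Continuity and differentiability of quaternion multiplication *)

Section QuaternionTopology.
Variable R : realType.
Implicit Types x y z : quat R.

Lemma coefq_continuous (i : 'I_4) : continuous (@coefq R ^~ i).
Proof. exact: coord_continuous. Qed.

(** Expanding in the basis 1, i, j, k reduces coordinatewise convergence to limits of sums and
    scalar multiples. *)
Lemma mkquatE (a b c d : R) : mkquat a b c d =
  a *: mkquat 1 0 0 0 + b *: mkquat 0 1 0 0 +
  c *: mkquat 0 0 1 0 + d *: mkquat 0 0 0 1.
Proof.
by apply: quatP;
  rewrite !coefqD !coefqZ !coefq_mk !(mulr0, mulr1, addr0, add0r).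
Qed.

Lemma cvg_mkquat (T : Type) (F : set_system T) {FF : Filter F}
    (f0 f1 f2 f3 : T -> R) (a0 a1 a2 a3 : R) :
  f0 @ F --> a0 -> f1 @ F --> a1 -> f2 @ F --> a2 -> f3 @ F --> a3 ->
  (fun t => mkquat (f0 t) (f1 t) (f2 t) (f3 t)) @ F --> mkquat a0 a1 a2 a3.
Proof.
move=> h0 h1 h2 h3; rewrite (mkquatE a0).
under eq_fun do rewrite mkquatE.
exact: cvgD (cvgD (cvgD (cvgZr_tmp h0) (cvgZr_tmp h1)) (cvgZr_tmp h2))
  (cvgZr_tmp h3).
Qed.

Lemma mulq_continuous : continuous (fun p : quat R * quat R => p.1 * p.2).
Proof.
move=> [x y].
have c1 i :
    (fun q : quat R * quat R => coefq q.1 i) @ (x, y) --> coefq x i.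
  by apply: (@cvg_comp _ _ _ fst (@coefq R ^~ i) _ (nbhs x));
    [exact: cvg_fst|exact: coefq_continuous].
have c2 i :
    (fun q : quat R * quat R => coefq q.2 i) @ (x, y) --> coefq y i.
  by apply: (@cvg_comp _ _ _ snd (@coefq R ^~ i) _ (nbhs y));
    [exact: cvg_snd|exact: coefq_continuous].
rewrite /continuous_at.
apply: (@cvg_mkquat _ (nbhs (x, y)) _).
exact: cvgB (cvgB (cvgB (cvgM (c1 0) (c2 0)) (cvgM (c1 1) (c2 1)))
  (cvgM (c1 2) (c2 2))) (cvgM (c1 3) (c2 3)).
exact: cvgB (cvgD (cvgD (cvgM (c1 0) (c2 1)) (cvgM (c1 1) (c2 0)))
  (cvgM (c1 2) (c2 3))) (cvgM (c1 3) (c2 2)).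
exact: cvgD (cvgD (cvgB (cvgM (c1 0) (c2 2)) (cvgM (c1 1) (c2 3)))
  (cvgM (c1 2) (c2 0))) (cvgM (c1 3) (c2 1)).
exact: cvgD (cvgB (cvgD (cvgM (c1 0) (c2 3)) (cvgM (c1 1) (c2 2)))
  (cvgM (c1 2) (c2 1))) (cvgM (c1 3) (c2 0)).
Qed.

Lemma cvg_mulq (T : Type) (F : set_system T) {FF : Filter F}
    (f g : T -> quat R) x y :
  f @ F --> x -> g @ F --> y -> (fun t => f t * g t) @ F --> x * y.
Proof.
move=> fx gy; apply: (cvg_comp2 fx gy); exact: (@mulq_continuous (x, y)).
Qed.

Lemma normsq_continuous : continuous (@normsq R).
Proof.
move=> x; have c i : (fun y => coefq y i ^+ 2) @ x --> coefq x i ^+ 2.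
  exact: (cvgM (@coefq_continuous i x) (@coefq_continuous i x)).
exact: cvgD (cvgD (cvgD (c 0) (c 1)) (c 2)) (c 3).
Qed.

Lemma scalerAlq (a : R) x y : a *: (x * y) = (a *: x) * y.
Proof. by apply: quatP; rewrite !(coefqZ, coefq_mk); ring. Qed.

Lemma scalerArq (a : R) x y : a *: (x * y) = x * (a *: y).
Proof. by apply: quatP; rewrite !(coefqZ, coefq_mk); ring. Qed.

(* [GRing.mul] itself already carries the bilinear structure of the product of
   a field, hence this alias. *)
Definition mulqb x y : quat R := x * y.

Fact mulqb_is_bilinear :
  bilinear_for
    (GRing.Scale.Law.clone _ _ *:%R _) (GRing.Scale.Law.clone _ _ *:%R _) mulqb.
Proof.
split=> [u'|u] a x y; rewrite /mulqb /=.
- by rewrite mulrDl scalerAlq.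
- by rewrite mulrDr scalerArq.
Qed.

HB.instance Definition _ := bilinear_isBilinear.Build R
  (quat R) (quat R) (quat R) _ _ mulqb mulqb_is_bilinear.

Lemma is_diff_mulq (p : quat R * quat R) :
  is_diff p (fun q : quat R * quat R => q.1 * q.2)
    (fun q : quat R * quat R => p.1 * q.2 + q.1 * p.2).
Proof.
pose B : {bilinear quat R -> quat R -> quat R} := mulqb.
have cB : continuous (fun q => B q.1 q.2) := mulq_continuous.
have dB := @differentiable_bilin R _ _ _ B p cB.
have eB := @diff_bilin R _ _ _ B p cB.
split; [exact: dB|exact: eB].
Qed.

(** The product rule, applied to [x * x] and then to [(x * x) * x]. Since the factors do not
    commute, the three positions of [v] stay distinct. *)
Lemma is_diff_cubeq x :
  is_diff x (fun y : quat R => y * y * y)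
    (fun v : quat R => v * x * x + x * v * x + x * x * v).
Proof.
have dsq : is_diff x (fun y : quat R => y * y) (fun v => x * v + v * x).
  exact: (is_diff_comp (is_diff_pair (is_diff_id x) (is_diff_id x))
    (is_diff_mulq (x, x))).
apply: is_diff_eq.
  exact: (is_diff_comp (is_diff_pair dsq (is_diff_id x))
    (is_diff_mulq (x * x, x))).
by apply/funext => v /=; rewrite mulrDl addrC [_ * v * _ + _]addrC.
Qed.

End QuaternionTopology.

(** * The Euclidean norm and continuity at infinity *)

Section QuaternionNorm.
Variable R : realType.
Implicit Types x y z : quat R.

Lemma coefqN x i : coefq (- x) i = - coefq x i.
Proof. by rewrite /coefq mxE. Qed.

Lemma normsq_ge0 x : 0 <= normsq x.
Proof. by rewrite /normsq !addr_ge0 ?sqr_ge0. Qed.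

Lemma normsq0 : normsq (0 : quat R) = 0.
Proof. by rewrite /normsq !coefq0 expr0n !addr0. Qed.

Lemma normsqM x y : normsq (x * y) = normsq x * normsq y.
Proof. by rewrite /normsq !coefq_mk; ring. Qed.

Lemma normsqZ (a : R) x : normsq (a *: x) = a ^+ 2 * normsq x.
Proof. by rewrite /normsq !coefqZ; ring. Qed.

Lemma normsqN x : normsq (- x) = normsq x.
Proof. by rewrite /normsq !coefqN; ring. Qed.

(** By the parallelogram identity, the two sides differ by [normsq (x - y)]. This replaces the
    triangle inequality for squared norms. *)
Lemma normsqD_le x y : normsq (x + y) <= 2 * normsq x + 2 * normsq y.
Proof.
rewrite -subr_ge0 (_ : _ - _ = normsq (x - y)) ?normsq_ge0 //.
by rewrite /normsq !coefqD !coefqN; ring.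
Qed.

Lemma normsq_gt0 x : x != 0 -> 0 < normsq x.
Proof. by move=> x0; rewrite lt_def normsq_neq0 ?normsq_ge0. Qed.

Lemma coefq_le x (i : 'I_4) : coefq x i ^+ 2 <= normsq x.
Proof.
have s j : 0 <= coefq x j ^+ 2 by exact: sqr_ge0.
have h0 := s 0; have h1 := s 1; have h2 := s 2; have h3 := s 3.
case: i => [[|[|[|[|//]]]] lti]; rewrite /normsq.
- rewrite (_ : Ordinal lti = 0); first lra.
  exact/val_inj.
- rewrite (_ : Ordinal lti = 1); first lra.
  exact/val_inj.
- rewrite (_ : Ordinal lti = 2); first lra.
  exact/val_inj.
- rewrite (_ : Ordinal lti = 3); first lra.
  exact/val_inj.
Qed.

Lemma closed_normsq_ball (L : R) : closed [set x : quat R | normsq x <= L].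
Proof.
apply: (@closed_comp _ _ (@normsq R) [set r | r <= L]); last exact: closed_le.
by move=> x _; exact: normsq_continuous.
Qed.

Lemma compact_normsq_ball (L : R) : compact [set x : quat R | normsq x <= L].
Proof.
apply: (@bounded_closed_compact R 4); last exact: closed_normsq_ball.
(* A coordinate of absolute value [b] satisfies [b ^+ 2 <= L], hence [b <= 1 + L]; this bounds the
   sup norm without a square root. *)
exists (1 + L); split; first exact: num_real.
move=> B LB x /= xL.
have L0 : 0 <= L := le_trans (normsq_ge0 x) xL.
rewrite [leLHS]/Num.Def.normr/= mx_normrE (bigmax_le _ _)//=.
  by apply: ltW; apply: lt_trans LB; lra.
move=> [i j] _ /=; rewrite ord1.
apply/ltW; apply: le_lt_trans LB.
have := le_trans (coefq_le x j) xL; rewrite /coefq -real_normK ?num_real //.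
have := normr_ge0 ((x : 'rV[R]_4) 0 j); set b := `|_|; nra.
Qed.

Lemma compact_normsq_bounded (K : set (quat R)) :
  compact K -> exists M, forall x, K x -> normsq x <= M.
Proof.
move=> cK; have [K0|/set0P/negP/negbNE/eqP ->] := pselect (K !=set0);
  last by exists 0.
have [c _ maxc] := compact_EVT_max K0 cK
  (continuous_subspaceT (@normsq_continuous R)).
by exists (normsq c) => x Kx; apply: maxc; rewrite inE.
Qed.

(** Only the points at infinity need properness. Growth of [F] uniform in [t] yields one
    neighbourhood of infinity that is mapped off a given compact set for every parameter at once. *)
Lemma extend_infty_param_continuous (T : topologicalType)
    (F : quat R * T -> quat R) :
  continuous F ->
  (forall M, exists L, forall x t, L <= normsq x -> M <= normsq (F (x, t))) ->
  continuous (fun p : S4 R * T =>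
    extend_infty (fun x => F (x, p.2)) p.1 : S4 R).
Proof.
move=> cF properF [[x|] t] U /=.
- move=> /(cF (x, t)) [[A B] /= [Ax Bt] ABU].
  exists (Some @` A, B) => [|[_ s] /= [[z Az <-] Bs]].
    by split=> //; exact: one_point_compactification_some_nbhs.
  exact: (ABU (z, s)).
- move=> [K [cK _] KU].
  have [M KM] := compact_normsq_bounded cK.
  (* The extra 1 makes the escape strict: [normsq] is at most [M] on [K]. *)
  have [L FL] := properF (M + 1).
  exists (Some @` (~` [set x | normsq x <= L]) `|` [set None], setT) => /=.
    split; last exact: filterT.
    exists [set x | normsq x <= L] => //.
    by split; [exact: compact_normsq_ball|exact: closed_normsq_ball].
  move=> [_ s] /= [[[z /negP zL <-]|->] _]; apply: KU; last by right.
  left; exists (F (z, s)) => // /KM; apply/negP; rewrite -ltNge.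
  rewrite -ltNge in zL; have := FL z s (ltW zL); lra.
Qed.

End QuaternionNorm.

(** * Growth of the characteristic map at infinity *)

Section Growth.
Variables (R : realType) (L : R).
Hypothesis L_ge1 : 1 <= L.
Implicit Types (f g p : quat R -> quat R) (k : nat).

(* Squaring both sides, this is [|f x| = O(|x|^k)] for the Euclidean norm. *)
Definition growth k f := exists2 C : R, 0 <= C &
  forall x, L <= normsq x -> normsq (f x) <= C * normsq x ^+ k.

Lemma growth_cst k (c : quat R) : growth k (fun=> c).
Proof.
exists (normsq c) => [|x Lx]; first exact: normsq_ge0.
by rewrite ler_peMr ?normsq_ge0 // exprn_ege1 // (le_trans L_ge1).
Qed.

Lemma growth_id : growth 1 id.
Proof. by exists 1 => // x _; rewrite mul1r expr1. Qed.

Lemma growthW k f : growth k f -> growth k.+1 f.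
Proof.
move=> [C C0 fC]; exists C => // x Lx; apply: le_trans (fC x Lx) _.
rewrite ler_wpM2l // exprS ler_peMl ?exprn_ge0 ?normsq_ge0 //.
exact: le_trans Lx.
Qed.

Lemma growthD k f g : growth k f -> growth k g -> growth k (fun x => f x + g x).
Proof.
move=> [C C0 fC] [D D0 gD]; exists (2 * C + 2 * D) => [|x Lx].
  by rewrite addr_ge0 // mulr_ge0.
apply: le_trans (normsqD_le _ _) _.
have := fC x Lx; have := gD x Lx; lra.
Qed.

Lemma growthN k f : growth k f -> growth k (fun x => - f x).
Proof. by move=> [C C0 fC]; exists C => // x Lx; rewrite normsqN fC. Qed.

Lemma growthB k f g : growth k f -> growth k g -> growth k (fun x => f x - g x).
Proof. by move=> fk gk; apply: growthD => //; exact: growthN. Qed.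

Lemma growthM k1 k2 f g :
  growth k1 f -> growth k2 g -> growth (k1 + k2) (fun x => f x * g x).
Proof.
move=> [C C0 fC] [D D0 gD]; exists (C * D) => [|x Lx]; first exact: mulr_ge0.
rewrite normsqM exprD mulrACA ler_pM ?normsq_ge0 //; [exact: fC|exact: gD].
Qed.

(** [normsq] is multiplicative with commuting real values, so the contributions of [p x] and its
    inverse cancel. Where [p x] vanishes, the whole product is 0. This is what controls the term of
    [charmap] containing the inverse. *)
Lemma growth_conj k p f g : growth k (fun x => f x * g x) ->
  growth k (fun x => p x * (f x * (p x)^-1 * g x)).
Proof.
move=> [C C0 fC]; exists C => // x Lx; apply: le_trans (fC x Lx).
rewrite !normsqM; have [->|p0] := eqVneq (p x) 0.
  by rewrite normsq0 mul0r mulr_ge0 ?normsq_ge0.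
have e : normsq (p x) * normsq (p x)^-1 = 1.
  by rewrite -normsqM divrr // /normsq !coefq_mk; ring.
rewrite [leLHS](_ : _ = normsq (p x) * normsq (p x)^-1 *
  (normsq (f x) * normsq (g x))).
  by rewrite e mul1r.
by ring.
Qed.

End Growth.

(** The product [(P - x) * (r - x)] contributes [x * x], and this is the only source of a cubic
    term. [Z] stands for the summand with the inverse, which is carried along unexpanded. *)
Lemma cubic_leading_part (T : pzRingType) (P x r p ci a Z : T) :
  (P - x) * (p - (r - x) * ci * (a - x) - Z) - x * x * ci * x =
  (P - x) * p - ((P * r - P * x - x * r) * ci * (a - x) + x * x * ci * a)
    - (P - x) * Z.
Proof.
rewrite !(mulrBr (P - x)) !(mulrA (P - x)).
have -> : (P - x) * (r - x) = (P * r - P * x - x * r) + x * x.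
  by rewrite mulrBr !mulrBl opprB addrA addrAC; congr (_ + _); rewrite addrAC.
rewrite (mulrDl _ (x * x)) (mulrDl _ (x * x * ci)) (mulrBr (x * x * ci)).
rewrite addrA [LHS]addrAC.
by congr (_ - _); rewrite opprB addrA addrAC addrK.
Qed.

Lemma charmap_growth (R : realType) (A : 'M[quat R]_3) :
  exists2 L, 1 <= L &
    growth L 2 (fun x => charmap A x - x * x * (A 0 2)^-1 * x).
Proof.
(* Beyond this radius [x] differs from the pole, so [charmap] is given by its generic branch. *)
pose P := charpole A; exists (1 + normsq P).
  by rewrite lerDl normsq_ge0.
have L1 : 1 <= 1 + normsq P by rewrite lerDl normsq_ge0.
pose a := A 0 0; pose b := A 0 1; pose ci := (A 0 2)^-1.
pose f := A 1 0; pose h := A 1 2; pose p := A 2 0; pose q := A 2 1.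
pose r := A 2 2.
have gc c := growth_cst L1 1 c.
have gx : growth (1 + normsq P) 1 id by exact: growth_id.
have gx0 := growthW L1.
have g0 c := growth_cst L1 0 c.
have gB c : growth (1 + normsq P) 1 (fun x => c - x) by exact: growthB.
have : growth (1 + normsq P) 2 (fun x => (P - x) * p
   - ((P * r - P * x - x * r) * ci * (a - x) + x * x * ci * a)
   - (P - x) * ((q - (r - x) * ci * b) * (P - x)^-1 * (f - h * ci * (a - x)))).
  apply: growthB; last first.
    (* Once the conjugating factor [P - x] is removed, a product of two affine functions of [x]
       remains. *)
    apply: growth_conj; apply: (@growthM _ _ 1 1);
      apply: growthB; do ?exact: gc.
      by apply: (@growthM _ _ 1 0) => //; apply: (@growthM _ _ 1 0).
    by apply: (@growthM _ _ 0 1).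
  apply: growthB; first exact: (@growthM _ _ 1 1).
  apply: growthD; last first.
    apply: (@growthM _ _ 2 0) => //; apply: (@growthM _ _ 2 0) => //.
    exact: (@growthM _ _ 1 1).
  apply: (@growthM _ _ 1 1) => //; apply: (@growthM _ _ 1 0) => //.
  apply: growthB; last exact: (@growthM _ _ 1 0).
  by apply: growthB => //; apply: (@growthM _ _ 0 1).
move=> [C C0 HC]; exists C => // x Lx; apply: le_trans (HC x Lx).
have xP : (x == P) = false.
  by apply/negP => /eqP xP; move: Lx; rewrite xP; lra.
rewrite /charmap xP -/P -/a -/b -/ci -/f -/h -/p -/q -/r.
rewrite le_eqVlt; apply/orP; left; apply/eqP; congr normsq.
exact: cubic_leading_part.
Qed.

(** * The homotopy to the cubing map *)

Section Paths.
Variable R : realType.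

(** The path avoids 0, so compactness of the unit interval gives the bound [e]. That bound makes the
    cubic term of the homotopy dominate uniformly in time. *)
Lemma path_to_oneq (w : quat R) : w != 0 ->
  exists2 u : R -> quat R, continuous u &
    [/\ u 0 = w, u 1 = 1 &
      exists2 e, 0 < e & forall t, 0 <= t <= 1 -> e <= normsq (u t)].
Proof.
move=> w0.
(* A real [w] may be negative: the segment to 1 is then pushed off the axis. *)
pose v : quat R := if [&& coefq w 1 == 0, coefq w 2 == 0 & coefq w 3 == 0]
  then mkquat 0 1 0 0 else 0.
pose u t : quat R := (1 - t) *: w + t *: (1 : quat R) + (t * (1 - t)) *: v.
have ucont : continuous u.
  move=> t; have ct : (fun s : R => s) @ t --> t := cvg_id.
  have c1t : (fun s : R => 1 - s) @ t --> 1 - t.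
    exact: cvgB (cvg_cst _) ct.
  exact: cvgD (cvgD (cvgZr_tmp c1t) (cvgZr_tmp ct)) (cvgZr_tmp (cvgM ct c1t)).
(* If [w] is real, the i-coordinate [t * (1 - t)] vanishes only at the endpoints, where the path is
   [w] or 1. Otherwise [v = 0], and some imaginary coordinate vanishes only at [t = 1], where the
   path is 1. *)
have un0 t : u t != 0.
  apply/eqP => ut0.
  have ci i : (1 - t) * coefq w i + t * coefq 1 i + t * (1 - t) * coefq v i = 0.
    by rewrite -!coefqZ -!coefqD -/(u t) ut0 coefq0.
  have := (conj (ci 0) (conj (ci 1) (conj (ci 2) (ci 3)))); rewrite /v.
  have -> : (1 : quat R) = mkquat 1 0 0 0 by [].
  rewrite !coefq_mk; case: ifPn => [/and3P[/eqP w1 /eqP w2 /eqP w3]|].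
    rewrite !coefq_mk w1 w2 w3 !(mulr0, mulr1, add0r, addr0) => -[e0 [e1 _]].
    have {}w0 : coefq w 0 != 0.
      by apply: contra_neq w0 => w00; apply: quatP; rewrite coefq0.
    move/eqP: e1; rewrite mulf_eq0 => /orP[/eqP t0|/eqP t1].
      by move: e0 w0; rewrite t0 subr0 mul1r addr0 => ->; rewrite eqxx.
    by move: e0; rewrite t1 mul0r add0r => t0; move: t1; rewrite t0; lra.
  rewrite !coefq0 !(mulr0, mulr1, add0r, addr0) => wn0 [e0 [e1 [e2 e3]]].
  have t1 : 1 - t != 0.
    by apply/eqP => t1; move: e0; rewrite t1 mul0r add0r; lra.
  move: wn0; move/eqP: e1; move/eqP: e2; move/eqP: e3.
  by rewrite !mulf_eq0 (negPf t1) /= => -> -> ->.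
have nu_cont : continuous (fun t => normsq (u t)).
  by move=> t; apply: continuous_comp; [exact: ucont|exact: normsq_continuous].
exists u => //; split.
- by rewrite /u subr0 mul0r !scale0r !addr0 scale1r.
- by rewrite /u subrr mulr0 !scale0r !addr0 add0r scale1r.
have [c _ minc] := EVT_min ler01 (continuous_subspaceT nu_cont).
by exists (normsq (u c)) => [|t t01]; [exact: normsq_gt0|exact: minc].
Qed.

(* Makes homotopies defined and continuous at every time [t : R]. *)
Definition clamp01 (t : R) : R := (`|t| - `|t - 1| + 1) / 2.

Lemma clamp01_itv t : 0 <= clamp01 t <= 1.
Proof. by rewrite /clamp01; case: (ger0P t); case: (ger0P (t - 1)); lra. Qed.

Lemma clamp010 : clamp01 0 = 0.
Proof. by rewrite /clamp01 sub0r normrN normr0 normr1 sub0r addNr mul0r. Qed.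

Lemma clamp011 : clamp01 1 = 1.
Proof. by rewrite /clamp01 subrr normr0 normr1; lra. Qed.

Lemma clamp01_continuous : continuous clamp01.
Proof.
move=> t; have ct : (fun s : R => s) @ t --> t := cvg_id.
have c1 : (fun=> 1 : R) @ t --> (1 : R) by exact: cvg_cst.
apply: cvgMr_tmp.
exact: (cvgD (cvgB (cvg_norm ct) (cvg_norm (cvgB ct c1))) c1).
Qed.

Definition cubeq (x : quat R) : quat R := x * x * x.

Lemma cubic_homotopy (m : quat R -> quat R) (w : quat R) (L : R) :
  continuous m -> w != 0 -> 1 <= L ->
  growth L 2 (fun x => m x - x * x * w * x) ->
  exists H : S4 R * R -> S4 R,
    [/\ continuous H, forall s, H (s, 0) = extend_infty m s &
        forall s, H (s, 1) = extend_infty cubeq s].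
Proof.
move=> cm w0 L1 [C C0 mC].
have [u cu [u0 u1 [e e0 ue]]] := path_to_oneq w0.
pose N x := m x - x * x * w * x.
pose F (p : quat R * R) : quat R :=
  (1 - clamp01 p.2) *: N p.1 + p.1 * p.1 * u (clamp01 p.2) * p.1.
have cF : continuous F.
  move=> [x t].
  have cx : (fun p : quat R * R => p.1) @ (x, t) --> x by exact: cvg_fst.
  have ct : (fun p : quat R * R => clamp01 p.2) @ (x, t) --> clamp01 t.
    by apply: (@cvg_comp _ _ _ snd clamp01 _ (nbhs t));
      [exact: cvg_snd|exact: clamp01_continuous].
  have cut : (fun p : quat R * R => u (clamp01 p.2)) @ (x, t) --> u (clamp01 t).
    by apply: (@cvg_comp _ _ _ _ u _ _ _ ct); exact: cu.
  have cmx : (fun p : quat R * R => m p.1) @ (x, t) --> m x.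
    by apply: (@cvg_comp _ _ _ _ m _ _ _ cx); exact: cm.
  have c1t : (fun p : quat R * R => 1 - clamp01 p.2) @ (x, t) --> 1 - clamp01 t.
    exact: cvgB (cvg_cst _) ct.
  have cxx : (fun p : quat R * R => p.1 * p.1) @ (x, t) --> x * x.
    exact: cvg_mulq.
  have cw : (fun=> w) @ (x, t) --> w by exact: cvg_cst.
  have cN : (fun p : quat R * R => N p.1) @ (x, t) --> N x.
    exact: cvgB cmx (cvg_mulq (cvg_mulq cxx cw) cx).
  exact: cvgD (cvgZ c1t cN) (cvg_mulq (cvg_mulq cxx cut) cx).
have properF M :
    exists L', forall x t, L' <= normsq x -> M <= normsq (F (x, t)).
  have M0 : 0 <= `|M| := normr_ge0 M.
  have q0 : 0 <= 2 * (C + `|M|) / e by apply: divr_ge0; lra.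
  (* With [n = normsq x], this radius gives [e * n >= 2 * (C + |M|)]. In [e * n ^+ 3 <= 2 * normsq
     (F (x, t)) + 2 * C * n ^+ 2] the [C] terms then cancel, leaving
     [normsq (F (x, t)) >= |M| * n ^+ 2 >= M]. *)
  exists (L + 2 * (C + `|M|) / e) => x t xK.
  have Lx : L <= normsq x by apply: le_trans xK; rewrite lerDl.
  have nx1 : 1 <= normsq x := le_trans L1 Lx.
  have /andP[t0 t1] := clamp01_itv t.
  have := mC x Lx; rewrite -/(N x) => NC.
  have := ue (clamp01 t) (clamp01_itv t) => uet.
  have big : 2 * (C + `|M|) <= e * normsq x.
    by rewrite -ler_pdivrMl // mulrC; apply: le_trans xK; lra.
  have dom : e * normsq x ^+ 3 <= 2 * normsq (F (x, t)) + 2 * normsq (N x).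
    have le1 : e * normsq x ^+ 3 <= normsq (x * x * u (clamp01 t) * x).
      rewrite !normsqM [leRHS](_ : _ = normsq (u (clamp01 t)) * normsq x ^+ 3).
        by rewrite ler_wpM2r // exprn_ge0 // normsq_ge0.
      by ring.
    apply: le_trans le1 _.
    rewrite [X in normsq X](_ : _ = F (x, t) - (1 - clamp01 t) *: N x);
      last by rewrite /F /= [_ *: _ + _]addrC addrK.
    apply: le_trans (normsqD_le _ _) _; rewrite normsqN lerD2l normsqZ.
    by rewrite ler_wpM2l // ler_piMl ?normsq_ge0 //; nra.
  have : normsq x ^+ 2 * (2 * (C + `|M|)) <= e * normsq x ^+ 3.
    rewrite [leRHS](_ : _ = normsq x ^+ 2 * (e * normsq x)); last by ring.
    by rewrite ler_wpM2l // sqr_ge0.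
  have : `|M| <= normsq x ^+ 2 * `|M|.
    by rewrite ler_peMl // exprn_ege1.
  have := ler_norm M; lra.
exists (fun p => extend_infty (fun x => F (x, p.2)) p.1); split.
- exact: extend_infty_param_continuous.
- move=> [x|] //=; rewrite /F /= clamp010 subr0 scale1r u0 /N.
  by rewrite subrK.
- move=> [x|] //=; rewrite /F /= clamp011 subrr scale0r add0r u1.
  by rewrite mulr1.
Qed.

End Paths.

(** * The cubing map: charts, Jacobian and fibre over i *)

Lemma cvg_mx (T : topologicalType) (m n : nat) (I : Type) (F : set_system I)
    {FF : Filter F} (f : I -> 'M[T]_(m, n)) (M : 'M[T]_(m, n)) :
  (forall i j, (fun x => f x i j) @ F --> M i j) -> f @ F --> M.
Proof.
move=> fM A [P MP PA].
apply: (@filterS _ F _ [set x | forall i j, P i j (f x i j)]).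
  by move=> x /PA.
apply: filter_forall => i; apply: filter_forall => j; exact: fM (MP i j).
Qed.

Section Cube.
Variable R : realType.
Implicit Types x u v : quat R.

Lemma cubeqE x : cubeq x = x ^+ 3.
Proof. by rewrite /cubeq !exprS expr0 mulr1 mulrA. Qed.

(** Cubing commutes with inversion and fixes both 0 and infinity, so the two charts give the same
    formula. *)
Lemma local_rep_cubeq (s : S4 R) :
  local_rep (extend_infty (@cubeq R)) s = @cubeq R.
Proof.
apply/funext => u; case: s => [x|] //; rewrite /local_rep /=.
case: eqVneq => [->|u0] /=; first by rewrite /cubeq mulr0.
by rewrite !cubeqE exprVn invrK.
Qed.

Lemma jacobian_cubeqE u i j : jacobian (@cubeq R) u i j =
  coefq ((delta_mx 0 i : quat R) * u * u + u * (delta_mx 0 i : quat R) * u +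
         u * u * (delta_mx 0 i : quat R)) j.
Proof. by rewrite mxE (@diff_val _ _ _ _ _ _ _ (is_diff_cubeq u)). Qed.

Lemma jacobian_cubeq_continuous : continuous (jacobian (@cubeq R)).
Proof.
move=> u; have nbhs_u : Filter (nbhs (u : quat R)) by exact: nbhs_filter.
apply: cvg_mx => i j.
under eq_fun do rewrite jacobian_cubeqE.
rewrite jacobian_cubeqE.
have ce : (fun=> (delta_mx 0 i : quat R)) @ u --> (delta_mx 0 i : quat R).
  exact: cvg_cst.
have cu : (fun x : quat R => x) @ u --> u by exact: cvg_id.
apply: (@cvg_comp _ _ _ _ (@coefq R ^~ j)); last exact: coefq_continuous.
exact: cvgD (cvgD (cvg_mulq (cvg_mulq ce cu) cu) (cvg_mulq (cvg_mulq cu ce) cu))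
  (cvg_mulq (cvg_mulq cu cu) ce).
Qed.

Lemma diff_cubeq_complex (a b : R) v (u := mkquat a b 0 0)
    (d := 3 * (a ^+ 2 - b ^+ 2)) (e := 6 * a * b) (s := 3 * a ^+ 2 - b ^+ 2) :
  v * u * u + u * v * u + u * u * v =
  mkquat (d * coefq v 0 - e * coefq v 1) (e * coefq v 0 + d * coefq v 1)
    (s * coefq v 2) (s * coefq v 3).
Proof.
by apply: quatP; rewrite !coefqD !coefq_mk /d /e /s; ring.
Qed.

(* On the complex line of [z] the differential of the cube is multiplication by
   [3 z^2]; on its orthogonal complement, where [z v = v conj(z)], it is
   multiplication by the real number [z^2 + z conj(z) + conj(z)^2]. *)
Lemma det_jacobian_cubeq (a b : R) :
  \det (jacobian (@cubeq R) (mkquat a b 0 0)) =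
  9 * (a ^+ 2 + b ^+ 2) ^+ 2 * (3 * a ^+ 2 - b ^+ 2) ^+ 2.
Proof.
pose d := 3 * (a ^+ 2 - b ^+ 2); pose e := 6 * a * b.
pose s := 3 * a ^+ 2 - b ^+ 2.
(* The matrix of multiplication by [d + e i], transposed because the Jacobian acts on row vectors.
   Its determinant is [d ^+ 2 + e ^+ 2 = 9 * (a ^+ 2 + b ^+ 2) ^+ 2]. *)
pose B : 'M[R]_2 :=
  \matrix_(i, j) (if i == j then d else if i == 0 then e else - e).
have -> : jacobian (@cubeq R) (mkquat a b 0 0) =
      @block_mx _ 2 2 2 2 B 0 0 s%:M.
  move: (jacobian _ _) (jacobian_cubeqE (mkquat a b 0 0)) => J JE.
  rewrite -[LHS](@submxK _ 2 2 2 2); congr (@block_mx _ 2 2 2 2 _ _ _ _);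
    apply/matrixP => i j;
    case: i => [[|[|//]] ?]; case: j => [[|[|//]] ?];
    rewrite !mxE JE diff_cubeq_complex /coefq !mxE /= -/d -/e -/s ?eqxx /=;
    rewrite ?(mulr0, mulr1, subr0, sub0r, addr0, add0r, oppr0) //.
transitivity (\det B * \det (s%:M : 'M[R]_2)).
  exact: (@det_ublock R 2 2).
rewrite det_scalar (expand_det_row _ 0) !big_ord_recl big_ord0.
rewrite /cofactor !det_mx11 !mxE /= /d /e /s; ring.
Qed.

Lemma C1_map_cubeq : continuous (extend_infty (@cubeq R)) ->
  C1_map (extend_infty (@cubeq R)).
Proof.
move=> cc; split=> // s; rewrite local_rep_cubeq; split.
  have F : Filter (nbhs (local_coord s : 'rV[R]_4)) by exact: nbhs_filter.
  apply: (@filterS _ _ F setT) filterT => u _.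
  exact: (@ex_diff _ _ _ _ _ _ _ (is_diff_cubeq u)).
exact: jacobian_cubeq_continuous.
Qed.

Definition s4_complex (a b : R) : S4 R := Some (mkquat a b 0 0).

Lemma s4_complex_inj (a b a' b' : R) :
  s4_complex a b = s4_complex a' b' -> a = a' /\ b = b'.
Proof.
move=> [e]; split.
- by have := congr1 (@coefq R ^~ 0) e; rewrite !coefq_mk.
- by have := congr1 (@coefq R ^~ 1) e; rewrite !coefq_mk.
Qed.

Definition sqrt34 : R := Num.sqrt (3 / 4).

Lemma sqrt34_sq : sqrt34 ^+ 2 = 3 / 4.
Proof. by rewrite sqr_sqrtr //; lra. Qed.

Lemma cubeq_eq_i (x : quat R) : cubeq x = mkquat 0 1 0 0 ->
  [\/ x = mkquat 0 (-1) 0 0, x = mkquat sqrt34 (1 / 2) 0 0 |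
      x = mkquat (- sqrt34) (1 / 2) 0 0].
Proof.
move=> xi.
(* A quaternion commutes with its own cube, here i, so [x] lies in the complex line spanned by 1 and
   i. What remains is to find complex cube roots of i. *)
have comm : x * mkquat 0 1 0 0 = mkquat 0 1 0 0 * x.
  by rewrite -xi /cubeq !mulrA.
have x2 : coefq x 2 = 0.
  by have := congr1 (@coefq R ^~ 3) comm; rewrite !coefq_mk; lra.
have x3 : coefq x 3 = 0.
  by have := congr1 (@coefq R ^~ 2) comm; rewrite !coefq_mk; lra.
set a := coefq x 0; set b := coefq x 1.
have ea : a * (a ^+ 2 - 3 * b ^+ 2) = 0.
  have := congr1 (@coefq R ^~ 0) xi; rewrite !coefq_mk x2 x3 -/a -/b => e.
  by rewrite -[RHS]e; ring.
have eb : b * (3 * a ^+ 2 - b ^+ 2) = 1.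
  have := congr1 (@coefq R ^~ 1) xi; rewrite !coefq_mk x2 x3 -/a -/b => e.
  by rewrite -[RHS]e; ring.
have xE a' b' : a = a' -> b = b' -> x = mkquat a' b' 0 0.
  by move=> <- <-; apply: quatP; rewrite coefq_mk.
move/eqP: ea; rewrite mulf_eq0 => /orP[/eqP a0|/eqP ab].
  (* Here [b ^+ 3 = -1], and [b ^+ 2 - b + 1] has no real root. *)
  apply: Or31; apply: xE => //; move: eb; rewrite a0.
  have -> : b * (3 * 0 ^+ 2 - b ^+ 2) = - b ^+ 3 by ring.
  move=> eb; have /eqP : (b + 1) * (b ^+ 2 - b + 1) = 0.
    by have -> : (b + 1) * (b ^+ 2 - b + 1) = b ^+ 3 + 1; [ring|lra].
  by rewrite mulf_eq0 => /orP[/eqP|/eqP]; nra.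
(* Substituting [a ^+ 2 = 3 * b ^+ 2] gives [8 * b ^+ 3 = 1], whose quadratic factor has no real
   root. *)
have b2 : b = 1 / 2.
  have a2 : a ^+ 2 = 3 * b ^+ 2 by lra.
  have b3 : b * (3 * (3 * b ^+ 2) - b ^+ 2) = 8 * b ^+ 3 by ring.
  rewrite a2 b3 in eb.
  have /eqP : (2 * b - 1) * (4 * b ^+ 2 + 2 * b + 1) = 0.
    have -> : (2 * b - 1) * (4 * b ^+ 2 + 2 * b + 1) = 8 * b ^+ 3 - 1 by ring.
    lra.
  by rewrite mulf_eq0 => /orP[/eqP|/eqP]; nra.
have /eqP : a ^+ 2 = sqrt34 ^+ 2.
  by rewrite sqrt34_sq; move: ab; rewrite b2; lra.
by rewrite eqf_sqr => /orP[]/eqP aE; [apply: Or32|apply: Or33]; apply: xE.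
Qed.

Lemma cubeq_complex (a b : R) : cubeq (mkquat a b 0 0) =
  mkquat (a * (a ^+ 2 - 3 * b ^+ 2)) (b * (3 * a ^+ 2 - b ^+ 2)) 0 0.
Proof. by apply: quatP; rewrite /cubeq !coefq_mk; ring. Qed.

Lemma extend_infty_cubeq_fiber :
  extend_infty (@cubeq R) @^-1` [set Some (mkquat 0 1 0 0)] =
  [set` [:: s4_complex 0 (-1); s4_complex sqrt34 (1 / 2);
            s4_complex (- sqrt34) (1 / 2)]].
Proof.
apply/seteqP; split=> [[x|] //= [/cubeq_eq_i]|s] /=.
  by rewrite !inE => -[->|->|->]; rewrite eqxx ?orbT.
rewrite !inE => /or3P[]/eqP ->; rewrite /s4_complex /= cubeq_complex;
  by congr (Some (mkquat _ _ _ _)); rewrite ?sqrrN ?sqrt34_sq; lra.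
Qed.

(** The determinant is a positive multiple of two squares. The hypothesis also excludes
    [a ^+ 2 + b ^+ 2 = 0], which would force [a = b = 0]. *)
Lemma jacobian_det_s4_complex (a b : R) : 3 * a ^+ 2 - b ^+ 2 != 0 ->
  0 < jacobian_det (extend_infty (@cubeq R)) (s4_complex a b).
Proof.
move=> s0; rewrite /jacobian_det local_rep_cubeq /local_coord /=.
rewrite det_jacobian_cubeq.
apply: mulr_gt0; last by rewrite exprn_even_gt0.
apply: mulr_gt0; first by rewrite ltr0n.
rewrite exprn_even_gt0 //=.
by apply: contra_neq s0 => ab; have := sqr_ge0 a; have := sqr_ge0 b; nra.
Qed.

End Cube.

(** * The degree of the characteristic map *)

Theorem proposition48 (R : realType) (A : 'M[quat R]_3)
    (offdiag_neq0 : forall i j : 'I_3, i != j -> A i j != 0)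
    (charmap_cont : continuous (charmap A)) :
  has_degree (extend_infty (charmap A)) 3.
Proof.
(* This is the coefficient of the cubic term, the starting point of the path to 1. *)
have cV0 : (A 0 2)^-1 != 0 by rewrite invr_eq0; exact: offdiag_neq0.
have [L L1 growthL] := charmap_growth A.
have [H [cH H0 H1]] := cubic_homotopy charmap_cont cV0 L1 growthL.
have cHt (t : R) : continuous (fun s => H (s, t)).
  move=> s; apply: (@continuous_comp _ _ _ (fun s => (s, t)) H); last exact: cH.
  move=> U [[P Q] /= [Ps Qt] PQU]; apply: filterS Ps => z Pz.
  by apply: PQU; split => //=; exact: nbhs_singleton Qt.
have sqrt34_neq0 : 3 * sqrt34 R ^+ 2 - (1 / 2) ^+ 2 != 0.
  by rewrite sqrt34_sq; apply/eqP; lra.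
(* Continuity at infinity is inherited from [H], whose slice at time 0 is the extended map. *)
split; first by rewrite -(funext H0); exact: cHt.
exists (extend_infty (@cubeq R)), (Some (mkquat 0 1 0 0)).
have det1 s : s \in [:: s4_complex 0 (-1); s4_complex (sqrt34 R) (1 / 2);
    s4_complex (- sqrt34 R) (1 / 2)] ->
    0 < jacobian_det (extend_infty (@cubeq R)) s.
  rewrite !inE => /or3P[]/eqP ->; apply: jacobian_det_s4_complex;
    rewrite ?sqrrN //.
  by apply/eqP; lra.
split.
- exists H; split=> //; exact: continuous_subspaceT.
- by apply: C1_map_cubeq; rewrite -(funext H1); exact: cHt.
- move=> s sy; rewrite gt_eqF // det1 //.
  have : (extend_infty (@cubeq R) @^-1` [set Some (mkquat 0 1 0 0)]) s by [].
  by rewrite extend_infty_cubeq_fiber.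
rewrite /signed_count extend_infty_cubeq_fiber -fsbig_seq; last first.
  (* Positivity separates the two roots with imaginary part [1 / 2], so the list has no repetition
     and the sum over the fibre has exactly three terms. *)
  have sqrt34_gt0 : 0 < sqrt34 R by rewrite sqrtr_gt0; lra.
  rewrite /= !inE negb_or !andbT; apply/andP; split; first (apply/andP; split);
    by apply/eqP => /s4_complex_inj[]; lra.
rewrite big_seq (eq_bigr (fun=> 1)); last by move=> s /det1; exact: gtr0_sgz.
by rewrite -big_seq !big_cons big_nil.
Qed.
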